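(* Let $S\in M_3(\mathbf{C})$ be the cyclic shift and for $t\in\mathbf{R}$ and $k=1,2,3$ put $$A_k(t)=S^{-k+1}\begin{pmatrix}t&0&0\\0&0&1\\0&1&0\end{pmatrix}S^{k-1}.$$ Let $A_k=A_k(-\tfrac12)$ and $B_k=A_k(1)$, and define the channels on $M_3(\mathbf{C})$ $$\Phi(\rho)=\tfrac49\sum_{k=1}^3A_k^*\rho A_k,\qquad\Psi(\rho)=\tfrac13\sum_{k=1}^3B_k^*\rho B_k.$$ Then $\Phi$ and $\Psi$ have exact factorizations through $M_3(\mathbf{C})\otimes M_3(\mathbf{C})$ which are dual in the sense that there is a single unitary matrix $\mathbf{U}\in M_3(\mathbf{C})\otimes M_3(\mathbf{C})$ such that for all $\rho\in M_3(\mathbf{C})$ $$\Phi(\rho)=(\mathcal{I}_3\otimes\mathrm{Tr})\big(\mathbf{U}^*(\rho\otimes\tfrac13I_3)\mathbf{U}\big)\quad\text{and}\quad\Psi(\rho)=(\mathrm{Tr}\otimes\mathcal{I}_3)\big(\mathbf{U}^*(\tfrac13I_3\otimes\rho)\mathbf{U}\big).$$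
   Context: $S=\sum_{k=1}^3|e_k\rangle\langle e_{k+1}|$ with $\{e_1,e_2,e_3\}$ the standard basis of $\mathbf{C}^3$ and indices mod $3$. $\mathrm{Tr}$ is the usual trace on $M_3(\mathbf{C})$ and $\mathcal{I}_3$ the identity map on $M_3(\mathbf{C})$. A unital, trace-preserving, completely positive map $\Phi$ on $M_3(\mathbf{C})$ has an exact factorization through $M_3(\mathbf{C})\otimes M_3(\mathbf{C})$ if there is a unitary $\mathbf{U}\in M_3(\mathbf{C})\otimes M_3(\mathbf{C})$ with $\Phi(\rho)=(\mathcal{I}_3\otimes\mathrm{Tr})(\mathbf{U}^*(\rho\otimes\tfrac13I_3)\mathbf{U})$ for all $\rho$. *)

(* Defs.v *)
From mathcomp Require Import all_boot all_order all_algebra.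
From mathcomp Require Import reals.
From mathcomp.real_closed Require Import complex mxtens.

Set Implicit Arguments.
Unset Strict Implicit.
Unset Printing Implicit Defensive.

Import Order.TTheory GRing.Theory Num.Theory.
Local Open Scope ring_scope.
Local Open Scope complex_scope.

Definition adjmx (C : numClosedFieldType) (m n : nat) (X : 'M[C]_(m, n)) :
  'M[C]_(n, m) := map_mx Num.conj X^T.

(* On a complex space nonnegativity of the quadratic form (in the order of C,
   hence in particular its reality) already forces X to be Hermitian. *)
Definition psdmx (C : numClosedFieldType) (n : nat) (X : 'M[C]_n) : Prop :=
  forall v : 'cV[C]_n, 0 <= (adjmx v *m X *m v) 0 0.

(* I_k (x) Phi, applied to X seen as a k x k matrix of n x n blocks. *)
Definition ampliation (C : numClosedFieldType) (n k : nat)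
    (Phi : 'M[C]_n -> 'M[C]_n) (X : 'M[C]_(k * n)) : 'M[C]_(k * n) :=
  \matrix_(a, b)
    Phi (\matrix_(i, j) X (mxtens_index ((mxtens_unindex a).1, i))
                          (mxtens_index ((mxtens_unindex b).1, j)))
        (mxtens_unindex a).2 (mxtens_unindex b).2.

Definition completely_positive (C : numClosedFieldType) (n : nat)
    (Phi : 'M[C]_n -> 'M[C]_n) : Prop :=
  linear Phi /\
  forall (k : nat) (X : 'M[C]_(k * n)), psdmx X -> psdmx (ampliation Phi X).

Definition unital_channel (C : numClosedFieldType) (n : nat)
    (Phi : 'M[C]_n -> 'M[C]_n) : Prop :=
  [/\ Phi 1%:M = 1%:M,
      forall rho, \tr (Phi rho) = \tr rho
    & completely_positive Phi].

(* The tensor product M_m(C) (x) M_n(C) is identified with M_(mn)(C) through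
   the Kronecker product tensmx; ptrace2 is I (x) Tr and ptrace1 is Tr (x) I. *)
Definition ptrace2 (C : numClosedFieldType) (m n : nat) (X : 'M[C]_(m * n)) :
  'M[C]_m :=
  \matrix_(i, j) \sum_(k < n) X (mxtens_index (i, k)) (mxtens_index (j, k)).

Definition ptrace1 (C : numClosedFieldType) (m n : nat) (X : 'M[C]_(m * n)) :
  'M[C]_n :=
  \matrix_(i, j) \sum_(k < m) X (mxtens_index (k, i)) (mxtens_index (k, j)).

Lemma ptrace2_tens (C : numClosedFieldType) (m n : nat)
  (X : 'M[C]_m) (Y : 'M[C]_n) : ptrace2 (tensmx X Y) = \tr Y *: X.
Proof.
apply/matrixP => i j; rewrite !mxE mulrC mulr_sumr.
by apply: eq_bigr => k _; rewrite tensmxE.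
Qed.

Lemma ptrace1_tens (C : numClosedFieldType) (m n : nat)
  (X : 'M[C]_m) (Y : 'M[C]_n) : ptrace1 (tensmx X Y) = \tr X *: Y.
Proof.
apply/matrixP => i j; rewrite !mxE mulr_suml.
by apply: eq_bigr => k _; rewrite tensmxE.
Qed.

Definition has_exact_factorization (C : numClosedFieldType) (n r : nat)
    (Phi : 'M[C]_n -> 'M[C]_n) : Prop :=
  unital_channel Phi /\
  exists2 U : 'M[C]_(n * r), U \is unitarymx &
    forall rho : 'M[C]_n,
      Phi rho = ptrace2 (adjmx U *m tensmx rho (r%:R^-1 *: 1%:M) *m U).

Definition shiftmx (R : realType) : 'M[R[i]]_3 :=
  \sum_(k < 3) delta_mx k (ordS k).

Definition coremx (R : realType) (t : R) : 'M[R[i]]_3 :=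
  \matrix_(i, j) nth 0 (nth [::] [:: [:: t%:C; 0; 0];
                                     [::    0; 0; 1];
                                     [::    0; 1; 0]] i) j.

(* k is 1-based, and ^ is the integer power: S^(-k+1) M S^(k-1). *)
Definition Amx (R : realType) (t : R) (k : nat) : 'M[R[i]]_3 :=
  shiftmx R ^ (1 - k%:Z) *m coremx t *m shiftmx R ^ (k%:Z - 1).

Definition Phi_channel (R : realType) (rho : 'M[R[i]]_3) : 'M[R[i]]_3 :=
  (4%:R / 9%:R) *: \sum_(1 <= k < 4)
     adjmx (Amx (- 2%:R^-1) k) *m rho *m Amx (- 2%:R^-1) k.

Definition Psi_channel (R : realType) (rho : 'M[R[i]]_3) : 'M[R[i]]_3 :=
  3%:R^-1 *: \sum_(1 <= k < 4) adjmx (Amx 1 k) *m rho *m Amx 1 k.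

(* Main.v *)
(* The unitary is U = (2/3) sum_k A_k (x) B_k.  The A_k are Hermitian and
   orthogonal for the trace form, and so are the B_k; hence tracing out one leg
   of U leaves only the diagonal terms of the double sum, a channel whose Kraus
   operators are those on the other leg.  For c <> d the product A_c A_d (x) B_c B_d
   is supported on a pair of 3-cycles, and summing over the pairs (c, d) with
   d - c fixed leaves the coefficients 1 + 2st and st + s + t, where s and t are
   the parameters of A and B: both vanish for s = -1/2, t = 1, and U^2 = 1. *)
Require Import Defs.
From HB Require Import structures.
From mathcomp Require Import all_boot all_order all_algebra.
From mathcomp Require Import reals.
From mathcomp.real_closed Require Import complex mxtens.
From mathcomp Require Import boolp ring.
Local Open Scope ring_scope.
Local Open Scope complex_scope.

Set Implicit Arguments.
Unset Strict Implicit.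
Unset Printing Implicit Defensive.

Import Order.TTheory GRing.Theory Num.Theory.

(** * Adjoints and linearity of the partial traces *)

Lemma adjmxM (C : numClosedFieldType) (m n p : nat)
    (X : 'M[C]_(m, n)) (Y : 'M[C]_(n, p)) :
  adjmx (X *m Y) = adjmx Y *m adjmx X.
Proof. by rewrite /adjmx trmx_mul map_mxM. Qed.

Lemma adjmxZ (C : numClosedFieldType) (m n : nat) (c : C) (X : 'M[C]_(m, n)) :
  adjmx (c *: X) = c^* *: adjmx X.
Proof. by rewrite /adjmx linearZ /= map_mxZ. Qed.

Lemma adjmx_sum (C : numClosedFieldType) (I : Type) (r : seq I) (m n : nat)
    (F : I -> 'M[C]_(m, n)) :
  adjmx (\sum_(k <- r) F k) = \sum_(k <- r) adjmx (F k).
Proof. by rewrite /adjmx !raddf_sum. Qed.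

Lemma adjmx_tens (C : numClosedFieldType) (m n p q : nat)
    (X : 'M[C]_(m, n)) (Y : 'M[C]_(p, q)) :
  adjmx (tensmx X Y) = tensmx (adjmx X) (adjmx Y).
Proof. by rewrite /adjmx trmx_tens map_mxT. Qed.

Lemma ptrace2_is_linear (C : numClosedFieldType) (m n : nat) :
  linear (@ptrace2 C m n).
Proof.
move=> a X Y; apply/matrixP => i j; rewrite !mxE mulr_sumr -big_split /=.
by apply: eq_bigr => k _; rewrite !mxE.
Qed.

HB.instance Definition _ (C : numClosedFieldType) (m n : nat) :=
  GRing.isLinear.Build C 'M[C]_(m * n) 'M[C]_m _ (@ptrace2 C m n)
    (@ptrace2_is_linear C m n).

Lemma ptrace1_is_linear (C : numClosedFieldType) (m n : nat) :
  linear (@ptrace1 C m n).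
Proof.
move=> a X Y; apply/matrixP => i j; rewrite !mxE mulr_sumr -big_split /=.
by apply: eq_bigr => k _; rewrite !mxE.
Qed.

HB.instance Definition _ (C : numClosedFieldType) (m n : nat) :=
  GRing.isLinear.Build C 'M[C]_(m * n) 'M[C]_n _ (@ptrace1 C m n)
    (@ptrace1_is_linear C m n).

(** * Partial traces of a conjugation by a sum of tensors *)

Lemma conj_sum_tens (C : numClosedFieldType) (r m n : nat) (a : C)
    (A : 'I_r -> 'M[C]_m) (B : 'I_r -> 'M[C]_n) (X : 'M[C]_m) (Y : 'M[C]_n) :
  let U := a *: \sum_k tensmx (A k) (B k) in
  adjmx U *m tensmx X Y *m U
  = `|a| ^+ 2 *: \sum_j \sum_k
      tensmx (adjmx (A j) *m X *m A k) (adjmx (B j) *m Y *m B k).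
Proof.
rewrite /= adjmxZ -!scalemxAl -scalemxAr scalerA normCKC; congr (_ *: _).
rewrite adjmx_sum !mulmx_suml; apply: eq_bigr => j _.
rewrite mulmx_sumr; apply: eq_bigr => k _.
by rewrite adjmx_tens !tensmx_mul.
Qed.

Definition kraus (C : numClosedFieldType) (n r : nat) (c : C)
    (V : 'I_r -> 'M[C]_n) (rho : 'M[C]_n) : 'M[C]_n :=
  c *: \sum_k adjmx (V k) *m rho *m V k.

(** The second leg of the term [(j, k)] contributes the scalar [s * \tr (adjmx (B j) *m B k)], so
    orthogonality of the [B k] kills every term off the diagonal. *)
Lemma ptrace2_sum_tens (C : numClosedFieldType) (r m n : nat) (a c s : C)
    (A : 'I_r -> 'M[C]_m) (B : 'I_r -> 'M[C]_n) (X : 'M[C]_m) :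
    (forall j k, \tr (adjmx (B j) *m B k) = c *+ (j == k)) ->
  let U := a *: \sum_k tensmx (A k) (B k) in
  ptrace2 (adjmx U *m tensmx X (s *: 1%:M) *m U)
  = kraus (`|a| ^+ 2 * (s * c)) A X.
Proof.
move=> trU; rewrite /= conj_sum_tens linearZ /kraus -scalerA; congr (_ *: _).
rewrite linear_sum scaler_sumr; apply: eq_bigr => j _.
rewrite linear_sum (bigD1 j) //= big1 => [|k kj]; rewrite ptrace2_tens.
  rewrite addr0 -scalemxAr -scalemxAl mulmx1 mxtraceZ trU eqxx.
  by rewrite mulr1n.
rewrite -scalemxAr -scalemxAl mulmx1 mxtraceZ trU eq_sym.
by rewrite (negPf kj) mulr0n mulr0 scale0r.
Qed.

Lemma ptrace1_sum_tens (C : numClosedFieldType) (r m n : nat) (a c s : C)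
    (A : 'I_r -> 'M[C]_m) (B : 'I_r -> 'M[C]_n) (X : 'M[C]_n) :
    (forall j k, \tr (adjmx (A j) *m A k) = c *+ (j == k)) ->
  let U := a *: \sum_k tensmx (A k) (B k) in
  ptrace1 (adjmx U *m tensmx (s *: 1%:M) X *m U)
  = kraus (`|a| ^+ 2 * (s * c)) B X.
Proof.
move=> trU; rewrite /= conj_sum_tens linearZ /kraus -scalerA; congr (_ *: _).
rewrite linear_sum scaler_sumr; apply: eq_bigr => j _.
rewrite linear_sum (bigD1 j) //= big1 => [|k kj]; rewrite ptrace1_tens.
  rewrite addr0 -scalemxAr -scalemxAl mulmx1 mxtraceZ trU eqxx.
  by rewrite mulr1n.
rewrite -scalemxAr -scalemxAl mulmx1 mxtraceZ trU eq_sym.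
by rewrite (negPf kj) mulr0n mulr0 scale0r.
Qed.

(** * Kraus maps as unital channels *)

Lemma kraus_is_linear (C : numClosedFieldType) (n r : nat) (c : C)
    (V : 'I_r -> 'M[C]_n) : linear (kraus c V).
Proof.
move=> a X Y; rewrite /kraus scalerA mulrC -scalerA -scalerDr; congr (_ *: _).
rewrite scaler_sumr -big_split /=; apply: eq_bigr => k _.
by rewrite mulmxDr mulmxDl -scalemxAr -scalemxAl.
Qed.

Lemma sum_mxtens (C : nmodType) (m n : nat) (F : 'I_(m * n) -> C) :
  \sum_a F a = \sum_(i < m) \sum_(j < n) F (mxtens_index (i, j)).
Proof.
rewrite pair_bigA /= (reindex (@mxtens_index m n)) /=.
  by apply: eq_bigr => -[].
by exists (@mxtens_unindex m n) => a _; [exact: mxtens_indexK|exact: mxtens_unindexK].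
Qed.

(** Conjugation by the tensor of the identity with [V j] acts on each block separately. Complete
    positivity of Kraus maps thus reduces to plain positivity. *)
Lemma ampliation_kraus (C : numClosedFieldType) (n r k : nat) (c : C)
    (V : 'I_r -> 'M[C]_n) (X : 'M[C]_(k * n)) :
  ampliation (kraus c V) X = kraus c (fun j => tensmx (1%:M : 'M_k) (V j)) X.
Proof.
have block (W : 'M[C]_n) (a b : 'I_k) (i j : 'I_n) :
  (adjmx (tensmx (1%:M : 'M_k) W) *m X *m tensmx (1%:M : 'M_k) W)
      (mxtens_index (a, i)) (mxtens_index (b, j))
  = (adjmx W *m (\matrix_(x, y) X (mxtens_index (a, x)) (mxtens_index (b, y)))
       *m W) i j.
  rewrite adjmx_tens /adjmx trmx1 map_mx1 mxE sum_mxtens (bigD1 b) //=.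
  (* The identity leg leaves only the outer index [b] on the right factor and, below, only [a] on
     the left one. *)
  rewrite [X in _ + X]big1 ?addr0 => [|x xb]; last first.
    by rewrite big1 // => y _; rewrite tensmxE !mxE (negPf xb) mul0r mulr0.
  rewrite mxE; apply: eq_bigr => y _.
  rewrite tensmxE !mxE eqxx mul1r; congr (_ * _).
  rewrite sum_mxtens (bigD1 a) //= [X in _ + X]big1 ?addr0 => [|x xa].
    by apply: eq_bigr => z _; rewrite tensmxE !mxE eqxx mul1r.
  by rewrite big1 // => z _; rewrite tensmxE !mxE eq_sym (negPf xa) !mul0r.
apply/matrixP => a b.
case: (mxtens_indexP a) => a1 a2; case: (mxtens_indexP b) => b1 b2.
rewrite mxE !mxtens_indexK /= !mxE !summxE; congr (_ * _).
by apply: eq_bigr => j _; rewrite block.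
Qed.

Lemma psdmx_kraus (C : numClosedFieldType) (n r : nat) (c : C)
    (V : 'I_r -> 'M[C]_n) (X : 'M[C]_n) :
  0 <= c -> psdmx X -> psdmx (kraus c V X).
Proof.
move=> c0 psdX v; rewrite /kraus -scalemxAr -scalemxAl mxE mulr_ge0 //.
rewrite mulmx_sumr mulmx_suml summxE sumr_ge0 // => k _.
(* The form of the conjugated matrix at [v] is the form of [X] at [V k *m v]. *)
by have := psdX (V k *m v); rewrite adjmxM !mulmxA.
Qed.

(** The first sum is the image of the identity; the second appears under the trace once its factors
    are permuted cyclically. *)
Lemma kraus_unital_channel (C : numClosedFieldType) (n r : nat) (c : C)
    (V : 'I_r -> 'M[C]_n) :
    0 <= c ->
    c *: \sum_k adjmx (V k) *m V k = 1%:M ->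
    c *: \sum_k V k *m adjmx (V k) = 1%:M ->
  unital_channel (kraus c V).
Proof.
move=> c0 VstarV VVstar; split.
- by rewrite -[RHS]VstarV; congr (_ *: _); apply: eq_bigr => k _; rewrite mulmx1.
- move=> rho; rewrite -[in RHS](mul1mx rho) -VVstar -scalemxAl !mxtraceZ.
  rewrite mulmx_suml !raddf_sum; congr (_ * _); apply: eq_bigr => k _ /=.
  by rewrite mxtrace_mulC mulmxA.
- split; first exact: kraus_is_linear.
  by move=> k X psdX; rewrite ampliation_kraus; apply: psdmx_kraus.
Qed.

(** * Weighted reflections of Z/3 and their products *)

(* The paper's A_(c+1)(t): for t = 1 it is the permutation matrix of the
   reflection i |-> 2c - i of Z/3. *)
Definition reflmx (C : pzRingType) (t : C) (c : 'I_3) : 'M[C]_3 :=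
  \matrix_(i, j)
    if i == j then if i == c then t else 0
    else if (i != c) && (j != c) then 1 else 0.

Lemma adjmx_reflmx (C : numClosedFieldType) (t : C) (c : 'I_3) :
  t \is Num.real -> adjmx (reflmx t c) = reflmx t c.
Proof.
move=> tR; apply/matrixP => i j; rewrite !mxE (eq_sym j) andbC.
case: eqP => [->|_]; case: ifP; rewrite ?rmorph0 ?rmorph1 // => _.
exact/CrealP.
Qed.

(** Each square is diagonal, with [t ^+ 2] at [c] and 1 elsewhere. *)
Lemma sum_reflmx_sqr (C : comNzRingType) (t : C) :
  \sum_c reflmx t c *m reflmx t c = (t ^+ 2 + 2%:R)%:M.
Proof.
apply/matrixP => i j; rewrite summxE !big_ord_recl big_ord0 !mxE.
rewrite !big_ord_recl !big_ord0 !mxE.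
by case: i => [[|[|[|//]]] ?]; case: j => [[|[|[|//]]] ?] /=; ring.
Qed.

(** For distinct [c] and [d] the product is supported on a rotation of Z/3 without fixed points, so
    its diagonal vanishes. *)
Lemma tr_reflmxM (C : comNzRingType) (t : C) (c d : 'I_3) :
  \tr (reflmx t c *m reflmx t d) = (t ^+ 2 + 2%:R) *+ (c == d).
Proof.
rewrite /mxtrace !big_ord_recl big_ord0 !mxE !big_ord_recl !big_ord0 !mxE.
by case: c => [[|[|[|//]]] ?]; case: d => [[|[|[|//]]] ?] /=; ring.
Qed.

(** The reflections in [c], then [d], compose to [i |-> i + 2(d - c)], and -2 = 1 mod 3. For
    [c <> d] a weight [t] enters at [i = c] and at [j = d], never at both; the remaining entry goes
    from [d] to [c]. *)
Lemma reflmxM (C : comNzRingType) (t : C) (c d i j : 'I_3) :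
  (reflmx t c *m reflmx t d) i j =
  if c == d then (if i == j then (if i == c then t ^+ 2 else 1) else 0)
  else if j == ((i + c + 2 * d) %% 3)%N :> nat then
    (if (i == d) && (j == c) then 1 else t) else 0.
Proof.
rewrite !mxE !big_ord_recl !big_ord0 !mxE.
by case: c => [[|[|[|//]]] ?]; case: d => [[|[|[|//]]] ?] /=;
  case: i => [[|[|[|//]]] ?]; case: j => [[|[|[|//]]] ?] /=; ring.
Qed.

(* With s = -1/2 and t = 1 the first leg carries the Kraus operators of Phi and
   the second those of Psi; exchanging s and t exchanges the two legs. *)
Definition dual_unitary (C : numClosedFieldType) (s t : C) : 'M[C]_(3 * 3) :=
  (2%:R / 3%:R) *: \sum_c tensmx (reflmx s c) (reflmx t c).

Lemma dual_unitaryP (C : numClosedFieldType) (s t : C) :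
    s \is Num.real -> t \is Num.real ->
    s + t = 2%:R^-1 -> s * t = - 2%:R^-1 ->
  dual_unitary s t \is unitarymx.
Proof.
move=> sR tR sDt sMt.
(* As U is Hermitian, unitarity becomes U^2 = 1, checked entry by entry. *)
have adjU : adjmx (dual_unitary s t) = dual_unitary s t.
  rewrite adjmxZ adjmx_sum; congr (_ *: _).
    by rewrite geC0_conj // divr_ge0 ?ler0n.
  by apply: eq_bigr => c _; rewrite adjmx_tens !adjmx_reflmx.
apply/unitarymxP; rewrite -/(adjmx _) adjU.
rewrite -scalemxAl -scalemxAr scalerA mulmx_suml.
under eq_bigr => c _.
  rewrite mulmx_sumr; under eq_bigr => d _ do rewrite tensmx_mul; over.
apply/matrixP => a b.
case: (mxtens_indexP a) => i j; case: (mxtens_indexP b) => k l.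
rewrite !mxE summxE (can_eq (@mxtens_indexK 3 3)).
under eq_bigr => c _.
  rewrite summxE; under eq_bigr => d _ do rewrite tensmxE !reflmxM. over.
rewrite !big_ord_recl !big_ord0 /=.
(* The sum and product make [s] and [t] the two roots of (x - 1)(x + 1/2); with numerical values
   every entry is a closed identity. *)
have [[-> ->]|[-> ->]] : s = 1 /\ t = - 2%:R^-1 \/ s = - 2%:R^-1 /\ t = 1.
  have tE : t = 2%:R^-1 - s by rewrite -sDt addrC addKr.
  have : (s - 1) * (s + 2%:R^-1) = 0.
    have -> : (s - 1) * (s + 2%:R^-1) = - (s * (2%:R^-1 - s)) - 2%:R^-1 by field.
    by rewrite -tE sMt opprK subrr.
  by move=> /eqP; rewrite mulf_eq0 subr_eq0 addr_eq0 tE => /orP[] /eqP ->;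
    [left|right]; split=> //; field.
all: case: i => [[|[|[|//]]] ?]; case: j => [[|[|[|//]]] ?];
  case: k => [[|[|[|//]]] ?]; case: l => [[|[|[|//]]] ?] /=.
all: by rewrite ?mulr1n ?mulr0n; field.
Qed.

(** The operators are Hermitian, so both normalisations are the same sum of squares. The scalar is
    4/9 at [t = -1/2] and 1/3 at [t = 1]. *)
Lemma kraus_reflmx_unital_channel (C : numClosedFieldType) (t : C) :
  t \is Num.real -> unital_channel (kraus (t ^+ 2 + 2%:R)^-1 (reflmx t)).
Proof.
move=> tR; have t2 : 0 < t ^+ 2 + 2%:R by rewrite ltr_wpDl ?real_exprn_even_ge0.
have sqr : (t ^+ 2 + 2%:R)^-1 *: \sum_c reflmx t c *m reflmx t c = 1%:M.
  by rewrite sum_reflmx_sqr scale_scalar_mx mulVf ?gt_eqF.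
apply: kraus_unital_channel; first by rewrite invr_ge0 ltW.
  by rewrite -[RHS]sqr; under eq_bigr => c _ do rewrite adjmx_reflmx //.
by rewrite -[RHS]sqr; under eq_bigr => c _ do rewrite adjmx_reflmx //.
Qed.

(** * Conjugation by the cyclic shift *)

Lemma shiftmxE (R : realType) (i j : 'I_3) :
  shiftmx R i j = (j == ordS i)%:R.
Proof.
rewrite /shiftmx !big_ord_recl big_ord0 !mxE.
by case: i => [[|[|[|//]]] ?]; case: j => [[|[|[|//]]] ?];
  rewrite /= ?addr0 ?add0r.
Qed.

Lemma shiftmxV (R : realType) : (shiftmx R)^-1 = (shiftmx R)^T.
Proof.
have SST : shiftmx R * (shiftmx R)^T = 1.
  apply/matrixP => i j; rewrite !mxE !big_ord_recl big_ord0 !mxE !shiftmxE.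
  by case: i => [[|[|[|//]]] ?]; case: j => [[|[|[|//]]] ?];
    rewrite /= ?(mulr0, mulr1, addr0, add0r).
have [SU _] := mulmx1_unit SST.
by rewrite -[LHS]mulr1 -SST mulKr.
Qed.

(** The shift permutes the basis cyclically, so conjugation by it translates the centre of a
    reflection. *)
Lemma reflmxS (R : realType) (t : R[i]) (c : 'I_3) :
  (shiftmx R)^-1 *m reflmx t c *m shiftmx R = reflmx t (ordS c).
Proof.
apply/matrixP => i j; rewrite shiftmxV !mxE.
rewrite !big_ord_recl !big_ord0 !mxE !big_ord_recl !big_ord0 !mxE !shiftmxE.
by case: c => [[|[|[|//]]] ?]; case: i => [[|[|[|//]]] ?];
  case: j => [[|[|[|//]]] ?] /=;
  rewrite ?(mulr0, mul0r, mulr1, mul1r, addr0, add0r).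
Qed.

Lemma coremxE (R : realType) (t : R) : coremx t = reflmx t%:C ord0.
Proof.
apply/matrixP => i j; rewrite !mxE.
by case: i => [[|[|[|//]]] ?]; case: j => [[|[|[|//]]] ?].
Qed.

Lemma reflmx_iterS (R : realType) (t : R[i]) (c : 'I_3) (m : nat) :
  (shiftmx R)^-1 ^+ m *m reflmx t c *m shiftmx R ^+ m
  = reflmx t (iter m (@ordS 3) c).
Proof.
elim: m => [|m IHm]; first by rewrite !expr0 mul1mx mulmx1.
by rewrite exprS exprSr /= -reflmxS -IHm !mulmxA.
Qed.

Lemma Amx_reflmx (R : realType) (t : R) (k : 'I_3) :
  Amx t k.+1 = reflmx t%:C k.
Proof.
(* With [k] counted from 0, both integer exponents become the natural power [k], of the inverse
   shift and of the shift. *)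
rewrite /Amx coremxE -[1 - _]opprB -exprz_inv -[k.+1]addn1 PoszD addrK.
rewrite -!exprnP reflmx_iterS; congr (reflmx _ _).
by case: k => [[|[|[|//]]] ?]; apply: val_inj.
Qed.

Lemma sum_Amx (R : realType) (t : R) (rho : 'M[R[i]]_3) :
  \sum_(1 <= k < 4) adjmx (Amx t k) *m rho *m Amx t k =
  \sum_(k < 3) adjmx (reflmx t%:C k) *m rho *m reflmx t%:C k.
Proof.
by rewrite big_add1 big_mkord; apply: eq_bigr => k _; rewrite Amx_reflmx.
Qed.

(** * The two factorizations and their duality *)

Theorem theorem4p8 (R : realType) :
  [/\ has_exact_factorization 3 (@Phi_channel R),
      has_exact_factorization 3 (@Psi_channel R)
    & exists U : 'M[R[i]]_(3 * 3),
        [/\ U \is unitarymx,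
            forall rho : 'M[R[i]]_3,
              Phi_channel rho
              = ptrace2 (adjmx U *m tensmx rho (3%:R^-1 *: 1%:M) *m U)
          & forall rho : 'M[R[i]]_3,
              Psi_channel rho
              = ptrace1 (adjmx U *m tensmx (3%:R^-1 *: 1%:M) rho *m U)]].
Proof.
pose s : R[i] := - 2%:R^-1.
have sR : s \is Num.real by rewrite realN realV realn.
have n23 : `|2%:R / 3%:R : R[i]| = 2%:R / 3%:R.
  by rewrite ger0_norm // divr_ge0 ?ler0n.
have PhiE : @Phi_channel R = kraus (s ^+ 2 + 2%:R)^-1 (reflmx s).
  apply: funext => rho; rewrite /Phi_channel sum_Amx /kraus.
  have -> : (- 2%:R^-1 : R)%:C = s by rewrite rmorphN fmorphV rmorph_nat.
  by congr (_ *: _); rewrite /s; field.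
have PsiE : @Psi_channel R = kraus (1 ^+ 2 + 2%:R)^-1 (reflmx 1).
  apply: funext => rho; rewrite /Psi_channel sum_Amx /kraus.
  by congr (_ *: _); field.
(* The squared trace norms 9/4 and 3 of the two legs satisfy (4/9)(1/3)(9/4)(3) = 1, so the norm of
   the leg traced out normalises the channel on the other. *)
have cs : `|2%:R / 3%:R : R[i]| ^+ 2 * (3%:R^-1 * (1 ^+ 2 + 2%:R))
          = (s ^+ 2 + 2%:R)^-1 by rewrite n23 /s; field.
have c1 : `|2%:R / 3%:R : R[i]| ^+ 2 * (3%:R^-1 * (s ^+ 2 + 2%:R))
          = (1 ^+ 2 + 2%:R)^-1 by rewrite n23 /s; field.
have trM (t : R[i]) : t \is Num.real -> forall j k,
    \tr (adjmx (reflmx t j) *m reflmx t k) = (t ^+ 2 + 2%:R) *+ (j == k).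
  by move=> tR j k; rewrite adjmx_reflmx // tr_reflmxM.
have PhiU rho : Phi_channel rho =
    ptrace2 (adjmx (dual_unitary s 1) *m tensmx rho (3%:R^-1 *: 1%:M)
             *m dual_unitary s 1).
  by rewrite PhiE (ptrace2_sum_tens _ _ _ _ (trM 1 (real1 _))) cs.
have PsiU rho : Psi_channel rho =
    ptrace1 (adjmx (dual_unitary s 1) *m tensmx (3%:R^-1 *: 1%:M) rho
             *m dual_unitary s 1).
  by rewrite PsiE (ptrace1_sum_tens _ _ _ _ (trM s sR)) c1.
have sD : s + 1 = 2%:R^-1 by rewrite /s; field.
have unitary_s1 : dual_unitary s 1 \is unitarymx.
  exact: dual_unitaryP sR (real1 _) sD (mulr1 s).
(* An exact factorization traces out the second leg, so the one for Psi takes the unitary with its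
   legs exchanged. *)
have unitary_1s : dual_unitary 1 s \is unitarymx.
  by apply: dual_unitaryP (real1 _) sR _ (mul1r s); rewrite addrC.
have PsiV rho : Psi_channel rho =
    ptrace2 (adjmx (dual_unitary 1 s) *m tensmx rho (3%:R^-1 *: 1%:M)
             *m dual_unitary 1 s).
  by rewrite PsiE (ptrace2_sum_tens _ _ _ _ (trM s sR)) c1.
split.
- split; last by exists (dual_unitary s 1); [exact: unitary_s1|exact: PhiU].
  by rewrite PhiE; exact: kraus_reflmx_unital_channel.
- split; last by exists (dual_unitary 1 s); [exact: unitary_1s|exact: PsiV].
  by rewrite PsiE; exact/kraus_reflmx_unital_channel/real1.
- by exists (dual_unitary s 1); split; [exact: unitary_s1|exact: PhiU|exact: PsiU].
Qed.
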